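(* Let $(T_n)_{n\ge 0}$ be the Tribonacci sequence: $T_0=0$, $T_1=1$, $T_2=1$ and $T_n=T_{n-1}+T_{n-2}+T_{n-3}$ for $n\ge 3$. Then for every integer $n\ge 0$: (a) $\sum_{k=0}^{n}T_{k}=\frac{1}{2}(T_{n+3}-T_{n+1}-1).$ (b) $\sum_{k=0}^{n}T_{2k}=\frac{1}{2}(T_{2n+1}+T_{2n}-1).$ (c) $\sum_{k=0}^{n}T_{2k+1}=\frac{1}{2}(T_{2n+2}+T_{2n+1}).$ *)

(* Defs.v *)
From mathcomp Require Import all_boot all_order all_algebra.

Set Implicit Arguments.
Unset Strict Implicit.
Unset Printing Implicit Defensive.

Fixpoint tribonacci (n : nat) : nat :=
  match n with
  | 0 => 0
  | 1 => 1
  | 2 => 1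
  | ((m.+1 as p).+1 as q).+1 => tribonacci q + tribonacci p + tribonacci m
  end.

Lemma tribonacciE (n : nat) : 3 <= n ->
  tribonacci n = tribonacci (n - 1) + tribonacci (n - 2) + tribonacci (n - 3).
Proof. by case: n => [|[|[|m]]] // _; rewrite !subSS !subn0. Qed.

(* Main.v *)
Require Import Defs.
From mathcomp Require Import all_boot all_order all_algebra.
From mathcomp Require Import lra.

Import GRing.Theory.
Local Open Scope ring_scope.

(** Induction on [n], the three identities being independent of each other. Passing from [n] to
    [n.+1] adds one term to the sum; twice that term equals the increment of the bracket on the
    right by a single use of the recurrence, at index [n+4], [2n+3] and [2n+4] respectively. *)

Lemma natr_tribonacciSSS (R : pzSemiRingType) (m : nat) :
  (tribonacci m.+3)%:R
    = (tribonacci m.+2)%:R + (tribonacci m.+1)%:R + (tribonacci m)%:R :> R.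
Proof. by rewrite -!natrD. Qed.

Theorem corollary2p3 (n : nat) :
  let T (k : nat) : rat := (tribonacci k)%:R in
  [/\ \sum_(0 <= k < n.+1) T k = 1 / 2 * (T (n + 3)%N - T (n + 1)%N - 1),
      \sum_(0 <= k < n.+1) T (2 * k)%N
        = 1 / 2 * (T (2 * n + 1)%N + T (2 * n)%N - 1)
    & \sum_(0 <= k < n.+1) T (2 * k + 1)%N
        = 1 / 2 * (T (2 * n + 2)%N + T (2 * n + 1)%N)].
Proof.
move=> T.
have TE m : T m.+3 = T m.+2 + T m.+1 + T m by exact: natr_tribonacciSSS.
have [T0 T1 T2] : [/\ T 0 = 0, T 1 = 1 & T 2 = 1] by [].
(* Only the recurrence and three initial values matter from here on; the values of [T] become atoms
   for [lra]. *)
clearbody T.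
elim: n => [|n [IHa IHb IHc]].
  by rewrite !big_nat1 !muln0 !add0n TE T0 T1 T2; split; lra.
have -> : (2 * n.+1 = (2 * n).+2)%N by rewrite mulnS.
(* Indices are put in successor form so that [TE] matches them. *)
rewrite !addnS !addn0 in IHa IHb IHc *.
split; rewrite big_nat_recr //=.
- by rewrite IHa !TE; lra.
- by rewrite IHb mulnS !TE; lra.
- by rewrite IHc mulnS !addnS !addn0 !TE; lra.
Qed.
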